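(* Let $\Phi:\mathbb{C}^{n\times n}\to\mathbb{C}^{m\times m}$ be the completely positive map with Kraus operators $A_1,\dots,A_p \in \mathbb{C}^{m\times n}$, let $\mathcal{A}=\operatorname{span}\{A_1,\dots,A_p\}$, and let $k$ be a nonnegative integer. The following are equivalent: (1) $\operatorname{ncrank}\mathcal{A} \ge k$; (2) $\Phi$ is $k$-scalable; (3) $\operatorname{cap}_k\Phi > -\infty$.
   Context: $\Phi(X) = \sum_i A_i X A_i^\dagger$, $\Phi^*(Y) = \sum_i A_i^\dagger Y A_i$. $\operatorname{ncrank}\mathcal{A} = \min\{m+n-\dim L-\dim R: L\subseteq\mathbb{C}^m, R\subseteq\mathbb{C}^n \text{ subspaces}, x^\dagger A_i y = 0 \ \forall x\in L, y\in R, i\in[p]\}$. For invertible $B\in\mathbb{C}^{m\times m}$, $C\in\mathbb{C}^{n\times n}$, the scaling $\Phi_{B,C}$ is the CP map with Kraus operators $BA_iC^\dagger$. The size of a CP map $\Psi$ is $\operatorname{Tr}\Psi(I_n)$. $\Psi$ is doubly substochastic if $\Psi(I_n)\preceq I_m$ and $\Psi^*(I_m)\preceq I_n$ (Loewner order). $\Phi$ is $k$-scalable if for every $\varepsilon>0$ some scaling of $\Phi$ is doubly substochastic and has size at least $k-\varepsilon$. Let $\mathcal{D} = \{(X,Y,z): X\in\mathbb{C}^{n\times n}, Y\in\mathbb{C}^{m\times m}\text{ Hermitian}, X\succeq I_n, Y\succeq I_m, z\in\mathbb{R}, z\ge 0\}$, $f_k(X,Y,z) = \operatorname{Tr}(\Phi(X^{-1})Y^{-1}e^z)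 + \log\det X + \log\det Y - kz$, and $\operatorname{cap}_k\Phi = \inf_{\mathcal{D}} f_k$. *)

(* Defs.v *)
From HB Require Import structures.
From mathcomp Require Import all_boot all_order all_algebra.
From mathcomp Require Import sesquilinear spectral.
From mathcomp Require Import complex.
From mathcomp Require Import boolp classical_sets reals ereal.
From mathcomp Require Import sequences exp.

Set Implicit Arguments.
Unset Strict Implicit.
Unset Printing Implicit Defensive.

Import Order.TTheory GRing.Theory Num.Theory.
Local Open Scope classical_set_scope.
Local Open Scope complex_scope.
Local Open Scope sesquilinear_scope.
Local Open Scope ring_scope.

Section Loewner.
Variables (R : realType) (n : nat).

Definition psdmx (M : 'M[R[i]]_n) : Prop :=
  M \is hermsymmx /\ forall v : 'cV[R[i]]_n, 0 <= (v ^t* *m M *m v) 0 0.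

Definition loewner_le (M N : 'M[R[i]]_n) : Prop := psdmx (N - M).

End Loewner.

(* A completely positive map is given by its family of Kraus operators. *)
Section CPMap.
Variables (R : realType) (m n p : nat).
Implicit Types (A : 'I_p -> 'M[R[i]]_(m, n)) (k : nat).

Definition cpmap A (X : 'M[R[i]]_n) : 'M[R[i]]_m :=
  \sum_(i < p) A i *m X *m (A i) ^t*.

Definition cpmap_dual A (Y : 'M[R[i]]_m) : 'M[R[i]]_n :=
  \sum_(i < p) (A i) ^t* *m Y *m A i.

Definition annihilating A (L : {vspace 'cV[R[i]]_m})
    (S : {vspace 'cV[R[i]]_n}) : Prop :=
  forall (i : 'I_p) (x : 'cV[R[i]]_m) (y : 'cV[R[i]]_n),
    x \in L -> y \in S -> x ^t* *m A i *m y = 0.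

(* The subtraction does not truncate: \dim L <= m and \dim S <= n. *)
Definition ncrank_value A (r : nat) : bool :=
  `[< exists (L : {vspace 'cV[R[i]]_m}) (S : {vspace 'cV[R[i]]_n}),
        annihilating A L S /\ r = (m + n - \dim L - \dim S)%N >].

Lemma ncrank_value_exists A : exists r, ncrank_value A r.
Proof.
exists (m + n - \dim (0%VS : {vspace 'cV[R[i]]_m})
              - \dim (0%VS : {vspace 'cV[R[i]]_n}))%N.
apply/asboolP; exists 0%VS, 0%VS; split=> // i x y _.
by rewrite memv0 => /eqP ->; rewrite mulmx0.
Qed.

(* The noncommutative rank of the span of the A_i: a pair (L, S) annihilates the
   span if and only if it annihilates its generators. *)
Definition ncrank A : nat := ex_minn (ncrank_value_exists A).

Definition scaling A (B : 'M[R[i]]_m) (C : 'M[R[i]]_n) :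
  'I_p -> 'M[R[i]]_(m, n) := fun i => B *m A i *m C ^t*.

(* The trace is a nonnegative real number; Re only changes its type to R. *)
Definition cpsize A : R := complex.Re (\tr (cpmap A 1%:M)).

Definition doubly_substochastic A : Prop :=
  loewner_le (cpmap A 1%:M) 1%:M /\ loewner_le (cpmap_dual A 1%:M) 1%:M.

Definition kscalable A k : Prop :=
  forall eps : R, 0 < eps ->
    exists (B : 'M[R[i]]_m) (C : 'M[R[i]]_n),
      [/\ B \in unitmx, C \in unitmx,
          doubly_substochastic (scaling A B C)
        & k%:R - eps <= cpsize (scaling A B C)].

Definition cap_domain : set ('M[R[i]]_n * 'M[R[i]]_m * R) :=
  [set w | [/\ w.1.1 \is hermsymmx, w.1.2 \is hermsymmx,
               loewner_le 1%:M w.1.1, loewner_le 1%:M w.1.2 & 0 <= w.2]].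

(* On cap_domain the trace and both determinants are real, the determinants
   being at least 1, so Re discards nothing. *)
Definition cap_fun A k (w : 'M[R[i]]_n * 'M[R[i]]_m * R) : R :=
  let: (X, Y, z) := w in
  complex.Re (\tr ((expR z)%:C *: (cpmap A (invmx X) *m invmx Y)))
  + ln (complex.Re (\det X)) + ln (complex.Re (\det Y)) - k%:R * z.

Definition cap A k : \bar R :=
  ereal_inf [set (cap_fun A k w)%:E | w in cap_domain].

End CPMap.

(* Main.v *)
(** The implications form a cycle (1) => (3) => (2) => (1).

    (1) => (3).  Diagonalise X and Y with decreasing eigenvalues e^x_j, e^y_i
    and index from 0.  For a < k, the eigenvectors of Y from position a on and
    those of X from position k - 1 - a on span spaces whose dimensions add up to
    m + n - k + 1, so they do not annihilate the A_l; by compactness some entry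
    of some A_l between them is at least a constant delta_a > 0.  As the
    eigenvalues decrease, the trace term is at least
    delta_a^2 e^(z - y_a - x_(k-1-a)).  Averaging over a < k and bounding each
    exponential by a tangent line absorbs -kz + sum x_j + sum y_i.

    (3) => (2).  Take (X, Y, z) minimising f_k up to t^2 and scale by
    e^(z/2) Y^(-1/2) and X^(-1/2).  Stretching Y or X by 1 + t along one
    eigenvector of the scaled Phi(I) or Phi^*(I), or increasing z by t, stays in
    the domain, so none of these moves gains more than t^2; this says precisely
    that the scaling is doubly substochastic up to a factor (1 + t)^2 and has
    size at least (k - t)(1 - t).

    (2) => (1).  If L, S annihilate a doubly substochastic map and P, Q project
    onto them, then P A_l Q = 0 gives
    Tr Phi(I) <= Tr (1 - P) Phi(I) + Tr (1 - Q) Phi^*(I)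
              <= m + n - dim L - dim S. *)

Require Import Defs.
From HB Require Import structures.
From mathcomp Require Import all_boot all_order all_algebra all_fingroup.
From mathcomp Require Import sesquilinear spectral complex ring lra zify.
From mathcomp Require Import boolp classical_sets reals ereal.
From mathcomp Require Import topology normedtype sequences exp.

Set Implicit Arguments.
Unset Strict Implicit.
Unset Printing Implicit Defensive.

Import Order.TTheory GRing.Theory Num.Theory.
Import numFieldNormedType.Exports.
Local Open Scope classical_set_scope.
Local Open Scope complex_scope.
Local Open Scope sesquilinear_scope.
Local Open Scope ring_scope.

(** * Adjoints and the Loewner order *)

Section Adjoint.
Variable C : numClosedFieldType.

Lemma adjmxM m n p (M : 'M[C]_(m, n)) (N : 'M[C]_(n, p)) :
  (M *m N) ^t* = N ^t* *m M ^t*.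
Proof. by rewrite trmx_mul map_mxM. Qed.

Lemma adjmxB m n (M N : 'M[C]_(m, n)) : (M - N) ^t* = M ^t* - N ^t*.
Proof. by rewrite linearB map_mxB. Qed.

Lemma adjmxZ m n (a : C) (M : 'M[C]_(m, n)) : (a *: M) ^t* = a^* *: M ^t*.
Proof. by rewrite linearZ map_mxZ. Qed.

Lemma adjmx_sum m n (I : finType) (F : I -> 'M[C]_(m, n)) :
  (\sum_i F i) ^t* = \sum_i (F i) ^t*.
Proof. by rewrite linear_sum map_mx_sum. Qed.

Lemma adjmx1 n : (1%:M : 'M[C]_n) ^t* = 1%:M.
Proof. by rewrite trmx1 map_mx1. Qed.

Lemma adjmx_unit n (M : 'M[C]_n) : (M ^t* \in unitmx) = (M \in unitmx).
Proof. by rewrite map_unitmx unitmx_tr. Qed.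

Lemma hermsymmxP n (M : 'M[C]_n) : reflect (M ^t* = M) (M \is hermsymmx).
Proof.
apply: (iffP (is_hermitianmxP _ _ _)); rewrite expr0 scale1r => H; exact: esym.
Qed.

(** In eigenbases of X and Y, each Kraus operator contributes a term of this shape to Tr(Phi(X^-1)
    Y^-1). *)
Lemma mxtrace_diag_conj m n (e : 'rV[C]_m) (d : 'rV[C]_n) (M : 'M[C]_(m, n)) :
  \tr (diag_mx e *m M *m diag_mx d *m M ^t*) =
  \sum_i \sum_j e 0 i * d 0 j * `|M i j| ^+ 2.
Proof.
rewrite /mxtrace; apply: eq_bigr => i _; rewrite mxE; apply: eq_bigr => j _.
rewrite mul_mx_diag mxE mul_diag_mx !mxE normCK; ring.
Qed.

Lemma mxtrace_mul_adj_ge0 m n (M : 'M[C]_(m, n)) : 0 <= \tr (M *m M ^t*).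
Proof.
apply: sumr_ge0 => i _; rewrite mxE; apply: sumr_ge0 => j _.
by rewrite !mxE mul_conjC_ge0.
Qed.

End Adjoint.

(** * Diagonal matrices with real entries *)

Section RealDiag.
Variables (R : realType) (n : nat).
Implicit Types d e : 'I_n -> R.

(** The entries stay in [R], so that eigenvalues can be ordered and passed to [ln]. *)
Definition rdiag d : 'M[R[i]]_n := diag_mx (\row_i (d i)%:C).

Lemma rdiagM d e : rdiag d *m rdiag e = rdiag (fun i => d i * e i).
Proof.
rewrite /rdiag mulmx_diag; congr diag_mx.
by apply/rowP => i; rewrite !mxE rmorphM.
Qed.

Lemma rdiag1 : rdiag (fun=> 1) = 1%:M.
Proof.
by rewrite /rdiag -diag_const_mx; congr diag_mx; apply/rowP => i; rewrite !mxE.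
Qed.

Lemma eq_rdiag d e : d =1 e -> rdiag d = rdiag e.
Proof. by move=> de; congr diag_mx; apply/rowP => i; rewrite !mxE de. Qed.

Lemma rdiagZ (a : R) d : a%:C *: rdiag d = rdiag (fun i => a * d i).
Proof.
rewrite /rdiag -linearZ; congr diag_mx.
by apply/rowP => i; rewrite !mxE rmorphM.
Qed.

Lemma rdiagB d e : rdiag d - rdiag e = rdiag (fun i => d i - e i).
Proof.
rewrite /rdiag -linearB; congr diag_mx.
by apply/rowP => i; rewrite !mxE rmorphB.
Qed.

Lemma rdiag_adj d : (rdiag d) ^t* = rdiag d.
Proof.
rewrite /rdiag tr_diag_mx map_diag_mx; congr diag_mx.
by apply/rowP => i; rewrite !mxE /= conj_Creal // complex_real.
Qed.

Lemma det_rdiag d : \det (rdiag d) = (\prod_i d i)%:C.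
Proof. by rewrite det_diag rmorph_prod; apply: eq_bigr => i _; rewrite mxE. Qed.

Lemma mxtrace_rdiag d : \tr (rdiag d) = (\sum_i d i)%:C.
Proof.
by rewrite mxtrace_diag rmorph_sum; apply: eq_bigr => i _; rewrite mxE.
Qed.

Lemma rdiag_inv d : (forall i, d i != 0) ->
  rdiag d *m rdiag (fun i => (d i)^-1) = 1%:M.
Proof.
by move=> d0; rewrite rdiagM -rdiag1; apply: eq_rdiag => i; rewrite divff.
Qed.

End RealDiag.

(** * Positive semidefinite matrices and spectral decompositions *)

Section Psd.
Variable R : realType.

Lemma psdmx_conj n q (M : 'M[R[i]]_n) (N : 'M[R[i]]_(n, q)) :
  psdmx M -> psdmx (N ^t* *m M *m N).
Proof.
move=> [/hermsymmxP hM psdM]; split.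
  by apply/hermsymmxP; rewrite !adjmxM trmxCK hM mulmxA.
by move=> v; have := psdM (N *m v); rewrite adjmxM !mulmxA.
Qed.

Lemma psdmx_rdiag n (d : 'I_n -> R) : (forall i, 0 <= d i) -> psdmx (rdiag d).
Proof.
move=> d0; split; first by apply/hermsymmxP; exact: rdiag_adj.
move=> v; rewrite mxE sumr_ge0 // => i _.
rewrite mul_mx_diag !mxE mulrAC [_^* * _]mulrC -normCK mulr_ge0 ?exprn_ge0 //.
by rewrite ler0c.
Qed.

Lemma psdmx_diag_ge0 n (M : 'M[R[i]]_n) i : psdmx M -> 0 <= M i i.
Proof.
move=> [_ /(_ (delta_mx i 0))].
rewrite trmx_delta map_delta_mx -rowE -colE !mxE //.
Qed.

Lemma psdmx_trace_ge0 n (M : 'M[R[i]]_n) : psdmx M -> 0 <= \tr M.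
Proof. by move=> psdM; apply: sumr_ge0 => i _; exact: psdmx_diag_ge0. Qed.

Lemma psdmxD n (M N : 'M[R[i]]_n) : psdmx M -> psdmx N -> psdmx (M + N).
Proof.
move=> [/hermsymmxP hM psdM] [/hermsymmxP hN psdN]; split.
  by apply/hermsymmxP; rewrite linearD map_mxD hM hN.
by move=> v; rewrite mulmxDr mulmxDl mxE addr_ge0.
Qed.

Lemma decreasing_perm n (d : 'I_n -> R) :
  exists s : 'S_n, forall i j : 'I_n, (i <= j)%N -> d (s j) <= d (s i).
Proof.
pose t := [tuple d i | i < n]; pose t' := sort_tuple >=%O t.
have /tuple_permP[s ts] : perm_eq t' t by rewrite perm_sort.
exists s => i j ij.
have nthE (k : 'I_n) : nth 0 t' k = d (s k).
  have -> : t' = [tuple tnth t (s i) | i < n] by apply: val_inj.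
  by rewrite -tnth_nth !tnth_mktuple.
rewrite -!nthE; apply: (sorted_leq_nth ge_trans ge_refl) => //.
- by apply: sort_sorted => x y; exact: ge_total.
- by rewrite inE size_tuple.
- by rewrite inE size_tuple.
Qed.

(** The eigenvectors are the adjoints of the rows of [U]. Permuting these rows sorts the real
    eigenvalues; the order serves [ncrank_cap]. *)
Lemma hermsymmx_spectral n (M : 'M[R[i]]_n) : M \is hermsymmx ->
  exists (U : 'M[R[i]]_n) (d : 'I_n -> R),
    [/\ U \is unitarymx, M = U ^t* *m rdiag d *m U
      & forall i j : 'I_n, (i <= j)%N -> d j <= d i].
Proof.
move=> hM; have /hermitian_normalmx/orthomx_spectralP := hM.
set U := spectralmx M; set d := spectral_diag M => ME.
have uU : U \is unitarymx by exact: spectral_unitarymx.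
pose e i := complex.Re (d 0 i).
have dE i : d 0 i = (e i)%:C.
  by rewrite RRe_real // (mxOverP (hermitian_spectral_diag_real hM)).
have [s sP] := decreasing_perm e.
exists (row_perm s U), (e \o s); split => //.
  apply/unitarymxP; rewrite row_permE adjmxM -mulmxA (mulmxA U).
  rewrite (unitarymxP uU) mul1mx tr_perm_mx map_perm_mx -perm_mxM mulgV.
  exact: perm_mx1.
rewrite {1}ME invmx_unitary //; apply/matrixP => i j; rewrite !mxE.
rewrite (reindex_inj (@perm_inj _ s)) /=; apply: eq_bigr => k _.
by rewrite !mul_mx_diag !mxE dE.
Qed.

Lemma unitarymx_adjl n (U : 'M[R[i]]_n) : U \is unitarymx -> U ^t* *m U = 1%:M.
Proof. by move=> /unitarymxP/mulmx1C. Qed.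

Lemma loewner1_herm n (X : 'M[R[i]]_n) : loewner_le 1%:M X -> X \is hermsymmx.
Proof.
case=> /hermsymmxP XX _; apply/hermsymmxP.
by move: XX; rewrite adjmxB adjmx1 => /(addIr _).
Qed.

(** Conjugating X - 1 by U gives the diagonal matrix of the d i - 1, whose entries are nonnegative
    because X - 1 is positive semidefinite. *)
Lemma loewner1_spectral n (X : 'M[R[i]]_n) : loewner_le 1%:M X ->
  exists (U : 'M[R[i]]_n) (d : 'I_n -> R),
    [/\ U \is unitarymx, X = U ^t* *m rdiag d *m U, forall i, 1 <= d i
      & forall i j : 'I_n, (i <= j)%N -> d j <= d i].
Proof.
move=> psdX; have [U [d [uU XE dP]]] := hermsymmx_spectral (loewner1_herm psdX).
exists U, d; split => // i.
have := psdmx_diag_ge0 i (psdmx_conj (U ^t*) psdX).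
rewrite trmxCK mulmxBr mulmxBl mulmx1 (unitarymxP uU) XE !mulmxA.
rewrite (unitarymxP uU) mul1mx -mulmxA (unitarymxP uU) mulmx1 !mxE !eqxx mulr1n.
by rewrite subr_ge0 (lecR 1).
Qed.

Lemma loewner_spectral n (U : 'M[R[i]]_n) (d : 'I_n -> R) (c : R) :
  U \is unitarymx -> (forall i, d i <= c) ->
  loewner_le (U ^t* *m rdiag d *m U) c%:C%:M.
Proof.
move=> uU dc; rewrite /loewner_le.
suff -> : c%:C%:M - U ^t* *m rdiag d *m U =
    U ^t* *m rdiag (fun i => c - d i) *m U.
  by apply/psdmx_conj/psdmx_rdiag => i; rewrite subr_ge0.
rewrite -rdiagB mulmxBr mulmxBl; congr (_ - _).
have -> : rdiag (fun=> c) = c%:C%:M :> 'M_n.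
  by rewrite -[RHS]diag_const_mx; congr diag_mx; apply/rowP => i; rewrite !mxE.
by rewrite mul_mx_scalar -scalemxAl unitarymx_adjl // scalemx1.
Qed.

Lemma invmx_spectral n (U : 'M[R[i]]_n) (d : 'I_n -> R) :
  U \is unitarymx -> (forall i, d i != 0) ->
  invmx (U ^t* *m rdiag d *m U) = U ^t* *m rdiag (fun i => (d i)^-1) *m U.
Proof.
move=> uU d0.
have H : (U ^t* *m rdiag d *m U) *m (U ^t* *m rdiag (fun i => (d i)^-1) *m U)
    = 1%:M.
  rewrite !mulmxA (mulmxtVK _ uU) -(mulmxA (U ^t*)) rdiag_inv // mulmx1.
  exact: unitarymx_adjl.
by rewrite -[RHS](mulKmx (proj1 (mulmx1_unit H))) H mulmx1.
Qed.

Lemma det_spectral n (U : 'M[R[i]]_n) (d : 'I_n -> R) : U \is unitarymx ->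
  \det (U ^t* *m rdiag d *m U) = (\prod_i d i)%:C.
Proof.
move=> uU; rewrite !det_mulmx mulrAC -det_mulmx unitarymx_adjl // det1 mul1r.
exact: det_rdiag.
Qed.

End Psd.

(** * Scalable maps have large rank *)

Section Frames.
Variable R : realType.
Local Notation C := R[i].

Lemma Re_ge0 (z : C) : 0 <= z -> 0 <= complex.Re z.
Proof. by rewrite lecE /= => /andP[_]. Qed.

Lemma Re_realM (c : R) (x : C) : complex.Re (c%:C * x) = c * complex.Re x.
Proof. by case: x => a b; simpc. Qed.

Lemma mxtrace_sum n (I : finType) (F : I -> 'M[C]_n) :
  \tr (\sum_i F i) = \sum_i \tr (F i).
Proof. by rewrite raddf_sum. Qed.

(** The rows are adjoints of basis vectors, so that the entries of V A U^* are the values x^* A y on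
    two bases. *)
Lemma vspace_frame m (L : {vspace 'cV[C]_m}) :
  exists V : 'M[C]_(\dim L, m),
    row_free V /\ forall i, (row i V) ^t* \in L.
Proof.
exists (\matrix_i ((vbasis L)`_i) ^t*); split.
  apply: inj_row_free => v /(congr1 (fun M => M ^t*)).
  rewrite mulmx_sum_row linear_sum map_mx_sum trmx0 map_mx0.
  under eq_bigr => i _ do rewrite adjmxZ rowK trmxCK.
  move/freeP: (basis_free (vbasisP L)) => /[apply] v0.
  apply/rowP => i; rewrite mxE; apply/eqP; rewrite -conjC_eq0.
  exact/eqP/v0.
by move=> i; rewrite rowK trmxCK vbasis_mem // mem_nth ?size_tuple.
Qed.

(** The space is the image of V^*, which is injective since V V^* = 1. *)
Lemma vspace_of_frame a m (V : 'M[C]_(a, m)) : V \is unitarymx ->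
  exists L : {vspace 'cV[C]_m}, \dim L = a /\
    forall x, x \in L -> exists u, x = V ^t* *m u.
Proof.
move=> uV; pose f : 'Hom('cV[C]_a, 'cV[C]_m) := linfun (mulmx (V ^t*)).
exists (limg f); split; last first.
  by move=> x /memv_imgP[u _ ->]; exists u; rewrite lfunE.
rewrite limg_dim_eq ?dimvf /dim /= ?muln1 //.
rewrite capfv; apply/eqP/lker0P => u v; rewrite !lfunE /= => uv.
rewrite -(mul1mx u) -(mul1mx v) -(unitarymxP uV) -!mulmxA.
by congr (_ *m _).
Qed.

End Frames.

(** * Annihilating pairs of subspaces as pairs of frames *)

Section NcrankFrames.
Variables (R : realType) (m n p : nat).
Local Notation C := R[i].
Implicit Type A : 'I_p -> 'M[C]_(m, n).

Lemma ncrank_le_frame A a b (V : 'M[C]_(a, m)) (U : 'M[C]_(b, n)) :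
  V \is unitarymx -> U \is unitarymx ->
  (forall l, V *m A l *m U ^t* = 0) -> (ncrank A <= m + n - a - b)%N.
Proof.
move=> uV uU VAU; rewrite /ncrank; case: ex_minnP => r _; apply.
apply/asboolP.
have [L [dL LV]] := vspace_of_frame uV; have [S [dS SU]] := vspace_of_frame uU.
exists L, S; rewrite dL dS; split => // l x y /LV[u ->] /SU[v ->].
rewrite adjmxM trmxCK !mulmxA -(mulmxA _ V) -(mulmxA _ (V *m _)) VAU.
by rewrite mulmx0 mul0mx.
Qed.

Lemma ncrank_attained A : exists a b (V : 'M[C]_(a, m)) (U : 'M[C]_(b, n)),
  [/\ row_free V, row_free U, forall l, V *m A l *m U ^t* = 0
    & ncrank A = (m + n - a - b)%N].
Proof.
rewrite /ncrank; case: ex_minnP => r /asboolP[L [S [LS ->]]] _.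
have [V [fV VL]] := vspace_frame L; have [U [fU US]] := vspace_frame S.
exists (\dim L), (\dim S), V, U; split => // l; apply/matrixP => i j.
have := LS l _ _ (VL i) (US j); rewrite trmxCK => /matrixP/(_ 0 0).
rewrite [in RHS]mxE [in X in _ -> _ = X]mxE => <-; rewrite -row_mul !mxE.
by apply: eq_bigr => q _; rewrite !mxE.
Qed.

Lemma row_free_unit_mul a q (V : 'M[C]_(a, q)) (B : 'M[C]_q) :
  row_free V -> B \in unitmx -> row_free (V *m B).
Proof. by rewrite /row_free => fV uB; rewrite mxrankMfree // row_free_unit. Qed.

Lemma mxtrace_cpmap A (X : 'M[C]_n) (Y : 'M[C]_m) :
  \tr (cpmap A X *m Y) = \tr (cpmap_dual A Y *m X).
Proof.
rewrite /cpmap /cpmap_dual !mulmx_suml !mxtrace_sum; apply: eq_bigr => l _.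
by rewrite /= -!mulmxA mxtrace_mulC !mulmxA -!mulmxA mxtrace_mulC !mulmxA.
Qed.

(** Three nonnegative traces add up to m + n - a - b - Tr Phi(I): those of 1 - Phi(I) compressed by
    1 - P and of 1 - Phi^*(I) compressed by 1 - Q, and the sum of the squared norms of (1 - P) A_l
    (1 - Q). *)
Lemma cpsize_le_frame A a b (V : 'M[C]_(a, m)) (U : 'M[C]_(b, n)) :
  V \is unitarymx -> U \is unitarymx -> (forall l, V *m A l *m U ^t* = 0) ->
  doubly_substochastic A -> cpsize A <= m%:R + n%:R - a%:R - b%:R.
Proof.
move=> uV uU VAU [rowA colA].
have projE c q (W : 'M[C]_(c, q)) : W \is unitarymx -> exists Q : 'M[C]_q,
    [/\ Q = W ^t* *m W, Q ^t* = Q, Q *m Q = Q & \tr Q = c%:R].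
  move=> uW; exists (W ^t* *m W); split => //.
  - by rewrite adjmxM trmxCK.
  - by rewrite !mulmxA mulmxtVK.
  - by rewrite mxtrace_mulC (unitarymxP uW) mxtrace1.
(* This is the trace of (1 - Q)(1 - M)(1 - Q), expanded. *)
have psdE q (Q M : 'M[C]_q) c : Q ^t* = Q -> Q *m Q = Q -> \tr Q = c%:R ->
    psdmx (1%:M - M) -> 0 <= q%:R - c%:R - \tr M + \tr (M *m Q).
  move=> Qh QQ trQ /(psdmx_conj (1%:M - Q))/psdmx_trace_ge0.
  have Q1 : (1%:M - Q) *m (1%:M - Q) = 1%:M - Q.
    by rewrite mulmxBr mulmxBl mul1mx mulmx1 mulmxBl mul1mx QQ subrr subr0.
  rewrite mxtrace_mulC mulmxA adjmxB adjmx1 Qh Q1 mxtrace_mulC.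
  rewrite mulmxBl mul1mx mulmxBr mulmx1 !raddfB /= mxtrace1 trQ => H.
  by apply: le_trans H _; rewrite le_eqVlt; apply/orP; left; apply/eqP; ring.
have [P [PE Ph PP trP]] := projE _ _ _ uV.
have [Q [QE Qh QQ trQ]] := projE _ _ _ uU.
have PAQ l : P *m A l *m Q = 0.
  by rewrite PE QE !mulmxA -(mulmxA _ V) -(mulmxA _ (V *m _)) VAU mulmx0 mul0mx.
have := psdE _ _ _ _ Ph PP trP rowA; have := psdE _ _ _ _ Qh QQ trQ colA.
have trE : \tr (cpmap_dual A 1%:M) = \tr (cpmap A 1%:M).
  by rewrite -[cpmap_dual _ _]mulmx1 -mxtrace_cpmap mulmx1.
have sE : 0 <= \tr (cpmap_dual A 1%:M) - \tr (cpmap_dual A 1%:M *m Q) -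
    \tr (cpmap A 1%:M *m P).
  rewrite /cpmap_dual /cpmap !mulmx_suml !mxtrace_sum -!sumrB.
  rewrite sumr_ge0 // => l _ /=.
  rewrite !mulmx1.
  have N1 : (1%:M - P) *m ((1%:M - P) *m A l *m (1%:M - Q)) =
      (1%:M - P) *m A l *m (1%:M - Q).
    rewrite !mulmxA; congr (_ *m _ *m _).
    by rewrite mulmxBr mulmxBl mul1mx mulmx1 mulmxBl mul1mx PP subrr subr0.
  have N2 : ((1%:M - P) *m A l *m (1%:M - Q)) *m (1%:M - Q) =
      (1%:M - P) *m A l *m (1%:M - Q).
    rewrite -mulmxA; congr (_ *m _).
    by rewrite mulmxBr mulmxBl mul1mx mulmx1 mulmxBl mul1mx QQ subrr subr0.
  have := mxtrace_mul_adj_ge0 ((1%:M - P) *m A l *m (1%:M - Q)).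
  set N := (1%:M - P) *m A l *m (1%:M - Q) in N1 N2 *.
  have -> : N ^t* = (1%:M - Q) *m ((A l) ^t* *m (1%:M - P)).
    by rewrite /N !adjmxM !adjmxB !adjmx1 Ph Qh.
  rewrite mulmxA N2 mulmxA mxtrace_mulC mulmxA N1.
  (* Here P A_l Q = 0 removes the cross term. *)
  have -> : N = A l - A l *m Q - P *m A l.
    rewrite /N mulmxBl mul1mx mulmxBr mulmx1 mulmxBl PAQ subr0.
    by rewrite addrAC.
  rewrite !mulmxBl !raddfB /= => H; apply: le_trans H _; rewrite le_eqVlt.
  apply/orP; left; apply/eqP; congr (_ - _ - _).
  - by rewrite mxtrace_mulC.
  - by rewrite mxtrace_mulC mulmxA.
  - by rewrite [RHS]mxtrace_mulC mulmxA.
move=> H1 H2; have := addr_ge0 (addr_ge0 H1 H2) sE => /Re_ge0.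
set z := (X in complex.Re X).
have -> : z = (m%:R + n%:R - a%:R - b%:R)%:C - \tr (cpmap A 1%:M).
  by rewrite /z trE !rmorphB rmorphD /= !rmorph_nat; ring.
by rewrite raddfB /= subr_ge0.
Qed.

(** Gram-Schmidt takes combinations of the rows, hence is a left factor D; the relation V A U^* = 0
    survives it. *)
Lemma frame_schmidt a q (V : 'M[C]_(a, q)) : row_free V ->
  exists D : 'M[C]_a, D *m V \is unitarymx.
Proof.
move=> fV; have /submxP[D DE] : (schmidt V <= V)%MS by rewrite eqmx_schmidt_free.
exists D; rewrite -DE schmidt_unitarymx //.
by rewrite -(eqP (fV : \rank V == a)) rank_leq_col.
Qed.

Lemma kscalable_ncrank A k : kscalable A k -> (k <= ncrank A)%N.
Proof.
have [a [b [V [U [fV fU VAU ->]]]]] := ncrank_attained A => Ak.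
(* With a <= m and b <= n the truncated subtraction in the rank agrees with the real one. *)
have am : (a <= m)%N by rewrite -(eqP (fV : \rank V == a)) rank_leq_col.
have bn : (b <= n)%N by rewrite -(eqP (fU : \rank U == b)) rank_leq_col.
rewrite -(ler_nat R) -subnDA natrB ?leq_add // !natrD opprD addrA.
apply/ler_addgt0Pr => eps eps0.
have [B [C' [uB uC dss sz]]] := Ak _ eps0.
(* The frames V B^-1 and U C'^-1 annihilate the scaled map, because they cancel B and the adjoint of
   C'. *)
have [D uD] := frame_schmidt (row_free_unit_mul fV (etrans (unitmx_inv B) uB)).
have [E uE] := frame_schmidt (row_free_unit_mul fU (etrans (unitmx_inv C') uC)).
rewrite -lerBlDr; apply: le_trans sz _; apply: cpsize_le_frame uD uE _ dss => l.
rewrite /scaling !adjmxM -!mulmxA (mulmxA (C' ^t*)).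
rewrite -(adjmxM (invmx C') C') mulVmx // adjmx1 mul1mx.
rewrite (mulmxA (invmx B)) mulVmx // mul1mx !mulmxA.
by rewrite -(mulmxA D) -(mulmxA D) VAU mulmx0 mul0mx.
Qed.

End NcrankFrames.

(** * Near minimisers give scalings *)

Section CapToScaling.
Variable R : realType.
Local Notation C := R[i].

Lemma psdmxZ n (c : R) (M : 'M[C]_n) : 0 <= c -> psdmx M -> psdmx (c%:C *: M).
Proof.
move=> c0 [/hermsymmxP hM psdM]; split.
  apply/hermsymmxP; rewrite adjmxZ hM; congr (_ *: _).
  by rewrite conj_Creal // complex_real.
by move=> v; rewrite -scalemxAr -scalemxAl mxE mulr_ge0 // ler0c.
Qed.

(** Z is a square root of X up to a unitary factor. For C = Z^-1 one has C^* C = X^-1, the argument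
    of Phi in [cap_fun]. *)
Lemma loewner1_factor n (X : 'M[C]_n) : loewner_le 1%:M X ->
  exists Z : 'M[C]_n, Z \in unitmx /\ X = Z *m Z ^t*.
Proof.
move=> /loewner1_spectral[U [d [uU -> d1 _]]].
have d0 i : 0 < d i by exact: lt_le_trans ltr01 (d1 i).
exists (U ^t* *m rdiag (fun i => Num.sqrt (d i))); split.
  rewrite unitmx_mul adjmx_unit unitarymx_unit //=.
  rewrite unitmxE det_rdiag unitfE; apply/eqP => /complexI/eqP.
  by rewrite gt_eqF // prodr_gt0 // => i _; rewrite sqrtr_gt0.
rewrite adjmxM trmxCK rdiag_adj !mulmxA; congr (_ *m _).
rewrite -mulmxA rdiagM; congr (_ *m _); apply: eq_rdiag => i.
by rewrite -expr2 sqr_sqrtr // ltW.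
Qed.

Lemma loewner1_det_gt0 n (X : 'M[C]_n) : loewner_le 1%:M X ->
  0 < complex.Re (\det X).
Proof.
move=> /loewner1_spectral[U [d [uU -> d1 _]]]; rewrite det_spectral //=.
by apply: prodr_gt0 => i _; exact: lt_le_trans ltr01 (d1 i).
Qed.

Lemma cpmap_adj m n p (A : 'I_p -> 'M[C]_(m, n)) :
  cpmap (fun l => (A l) ^t*) = cpmap_dual A.
Proof. by apply/funext => X; apply: eq_bigr => l _; rewrite trmxCK. Qed.

Lemma scaling_adj m n p (A : 'I_p -> 'M[C]_(m, n)) B D :
  scaling (fun l => (A l) ^t*) D B = fun l => (scaling A B D l) ^t*.
Proof. by apply/funext => l; rewrite /scaling !adjmxM trmxCK mulmxA. Qed.

(** Taking adjoints of the Kraus operators exchanges Phi with Phi^* and X with Y, so the bound on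
    the scaled Phi^*(I) will follow from that on the scaled Phi(I). *)
Lemma cap_fun_adj m n p (A : 'I_p -> 'M[C]_(m, n)) k X Y z :
  cap_fun (fun l => (A l) ^t*) k (Y, X, z) = cap_fun A k (X, Y, z).
Proof.
rewrite /cap_fun !mxtraceZ cpmap_adj -mxtrace_cpmap; congr (_ - _).
by rewrite addrAC.
Qed.

Lemma cap_domainE m n (X : 'M[C]_n) (Y : 'M[C]_m) (z : R) :
  cap_domain (X, Y, z) <-> [/\ loewner_le 1%:M X, loewner_le 1%:M Y & 0 <= z].
Proof.
by split=> [[]//|[X1 Y1 z0]]; split => //=; exact: loewner1_herm.
Qed.

Lemma cpmap_scaling m n p (A : 'I_p -> 'M[C]_(m, n)) B D :
  cpmap (scaling A B D) 1%:M = B *m cpmap A (D ^t* *m D) *m B ^t*.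
Proof.
rewrite /cpmap mulmx_sumr mulmx_suml; apply: eq_bigr => l _.
by rewrite /scaling mulmx1 !adjmxM trmxCK !mulmxA.
Qed.

Lemma invmx_mul n (M N : 'M[C]_n) : M \in unitmx -> N \in unitmx ->
  invmx (M *m N) = invmx N *m invmx M.
Proof.
move=> uM uN; have uMN : M *m N \in unitmx by rewrite unitmx_mul uM.
rewrite -[RHS](mulKmx uMN) -!mulmxA (mulmxA N) mulmxV // mul1mx mulmxV //.
by rewrite mulmx1.
Qed.

Lemma invmx_adj n (M : 'M[C]_n) : invmx (M ^t*) = (invmx M) ^t*.
Proof. by rewrite -map_invmx trmx_inv. Qed.

(** This gives f_k at a perturbation by [M] of Y = W W^* in terms of the scaled map; [M = 1] is the
    unperturbed value. *)
Lemma cap_fun_factor m n p (A : 'I_p -> 'M[C]_(m, n)) k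
    (Z : 'M[C]_n) (W M : 'M[C]_m) (z : R) :
  Z \in unitmx -> W \in unitmx -> M \in unitmx ->
  cap_fun A k (Z *m Z ^t*, W *m M *m W ^t*, z) =
  expR z * complex.Re
    (\tr (cpmap (scaling A (invmx W) (invmx Z)) 1%:M *m invmx M))
  + ln (complex.Re (\det (Z *m Z ^t*)))
  + ln (complex.Re (\det M * \det (W *m W ^t*))) - k%:R * z.
Proof.
move=> uZ uW uM; rewrite /cap_fun; congr (_ + _ + ln (complex.Re _) - _).
  rewrite mxtraceZ Re_realM; congr (_ * complex.Re _); rewrite cpmap_scaling.
  rewrite [invmx (W *m _ *m _)]invmx_mul ?adjmx_unit ?unitmx_mul ?uW //.
  rewrite (invmx_mul uW uM) invmx_mul ?adjmx_unit // !invmx_adj.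
  by rewrite -!mulmxA [RHS]mxtrace_mulC !mulmxA.
by rewrite !det_mulmx mulrCA mulrA.
Qed.

(** The infimum need not be attained. The slack [eta] will be t^2 for moves of size t, so that it is
    negligible to first order. *)
Definition near_min m n p (A : 'I_p -> 'M[C]_(m, n)) k w (eta : R) :=
  forall w', cap_domain w' -> cap_fun A k w <= cap_fun A k w' + eta.

Lemma cap_near_min m n p (A : 'I_p -> 'M[C]_(m, n)) k (eta : R) :
  (-oo < cap A k)%E -> 0 < eta ->
  exists2 w, cap_domain w & near_min A k w eta.
Proof.
move=> capA eta0; set S := [set (cap_fun A k w)%:E | w in @cap_domain R m n].
(* A point of the domain keeps the infimum below +oo, so it is finite. *)
have w0 : @cap_domain R m n (1%:M, 1%:M, 0).
  have psd0 q : loewner_le (1%:M : 'M[C]_q) 1%:M.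
    rewrite /loewner_le subrr; split; last by move=> v; rewrite mulmx0 mul0mx mxE.
    by apply/hermsymmxP; rewrite trmx0 map_mx0.
  exact/cap_domainE.
have cap_fin : cap A k \is a fin_num.
  rewrite fin_real // capA /=.
  apply: (@le_lt_trans _ _ (cap_fun A k (1%:M, 1%:M, 0))%:E).
    by apply: ereal_inf_lbound; exists (1%:M, 1%:M, 0).
  by rewrite ltry.
have [_ [w Dw <-] wlt] := lb_ereal_inf_adherent eta0 cap_fin.
exists w => // w' Dw'; rewrite -lee_fin EFinD; apply: le_trans (ltW wlt) _.
by rewrite leeD2r //; apply: ereal_inf_lbound; exists w'.
Qed.

End CapToScaling.

(** * First-order conditions at near minimisers *)

Section NearMinimizers.
Variable R : realType.
Local Notation C := R[i].

Lemma cpmap1_herm m n p (A : 'I_p -> 'M[C]_(m, n)) :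
  cpmap A 1%:M \is hermsymmx.
Proof.
apply/hermsymmxP; rewrite /cpmap adjmx_sum; apply: eq_bigr => l _.
by rewrite mulmx1 adjmxM trmxCK.
Qed.

Lemma cpsize_ge0 m n p (A : 'I_p -> 'M[C]_(m, n)) : 0 <= cpsize A.
Proof.
apply: Re_ge0; rewrite /cpmap mxtrace_sum.
by apply: sumr_ge0 => l _; rewrite mulmx1 mxtrace_mul_adj_ge0.
Qed.

(** Stretching by 1 + t along the j-th eigenvector of the scaled Phi(I), with eigenvalue q, lowers
    the trace term by e^z q t / (1 + t) and raises log det Y by ln (1 + t) <= t. As the gain is at
    most t^2, e^z q <= (t + t^2)(1 + t) / t = (1 + t)^2. *)
Lemma near_min_cpmap m n p (A : 'I_p -> 'M[C]_(m, n)) k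
    (Z : 'M[C]_n) (W : 'M[C]_m) (z t : R) :
  Z \in unitmx -> W \in unitmx -> 0 < t ->
  cap_domain (Z *m Z ^t*, W *m W ^t*, z) ->
  near_min A k (Z *m Z ^t*, W *m W ^t*, z) (t ^+ 2) ->
  loewner_le ((expR z)%:C *: cpmap (scaling A (invmx W) (invmx Z)) 1%:M)
    ((1 + t) ^+ 2)%:C%:M.
Proof.
move=> uZ uW t0 /cap_domainE[X1 Y1 z0] wmin.
set P := cpmap _ _.
have [U [d [uU PE _]]] := hermsymmx_spectral (cpmap1_herm _ : P \is hermsymmx).
rewrite PE scalemxAl scalemxAr rdiagZ; apply: loewner_spectral => // j.
pose e i : R := if i == j then 1 + t else 1.
have e0 i : 0 < e i by rewrite /e; case: ifP => _; rewrite ?addr_gt0.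
pose M := U ^t* *m rdiag e *m U.
have prode : \prod_i e i = 1 + t.
  rewrite (bigD1 j) //= big1 ?mulr1 /e ?eqxx // => i /negbTE ->//.
have detM : \det M = (1 + t)%:C by rewrite det_spectral // prode.
have uM : M \in unitmx.
  rewrite unitmxE detM unitfE; apply/eqP => /complexI/eqP.
  by rewrite gt_eqF // addr_gt0.
have Dw' : cap_domain (Z *m Z ^t*, W *m M *m W ^t*, z).
  apply/cap_domainE; split => //; rewrite /loewner_le.
  (* The perturbed Y stays above 1: it exceeds W W^* by the positive semidefinite W (M - 1) W^*. *)
  have -> : W *m M *m W ^t* - 1%:M = (W *m W ^t* - 1%:M) +
      (U *m W ^t*) ^t* *m rdiag (fun i => e i - 1) *m (U *m W ^t*).
    rewrite -rdiagB rdiag1 mulmxBr mulmxBl mulmx1 adjmxM trmxCK.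
    rewrite !mulmxA (mulmxKtV _ uU erefl).
    by rewrite [RHS]addrC addrA subrK.
  apply: psdmxD => //; apply/psdmx_conj/psdmx_rdiag => i; rewrite subr_ge0 /e.
  by case: ifP => // _; rewrite lerDl ltW.
have := wmin _ Dw'; rewrite cap_fun_factor // detM Re_realM.
(* Inserting [M = 1] puts the unperturbed value into the shape of [cap_fun_factor]. *)
have -> : W *m W ^t* = W *m 1%:M *m W ^t* by rewrite mulmx1.
rewrite cap_fun_factor ?unitmx1 // det1 mul1r mulmx1 -/P invmx1 mulmx1.
have Y0 := loewner1_det_gt0 Y1.
rewrite lnM ?posrE ?addr_gt0 //.
have -> : \tr P = (\sum_i d i)%:C.
  by rewrite PE mxtrace_mulC mulmxA (unitarymxP uU) mul1mx mxtrace_rdiag.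
have -> : \tr (P *m invmx M) = (\sum_i d i / e i)%:C.
  rewrite invmx_spectral // => [|i]; last by rewrite gt_eqF.
  rewrite PE !mulmxA (mulmxtVK _ uU) mxtrace_mulC !mulmxA (unitarymxP uU) mul1mx.
  by rewrite rdiagM mxtrace_rdiag.
rewrite /= [\sum_i d i](bigD1 j) // [\sum_i d i / e i](bigD1 j) //= {1}/e eqxx.
have -> : \sum_(i < m | i != j) d i / e i = \sum_(i < m | i != j) d i.
  by apply: eq_bigr => i /negbTE ij; rewrite /e ij divr1.
have : ln (1 + t) <= t by have := @le_ln1Dx R t; apply; lra.
set D := \sum_(i < m | _) _; set a := ln (1 + t); set b := ln _; set c := ln _.
set q := d j => at_ H.
have : expR z * q * (t / (1 + t)) <= t + t ^+ 2.
  have -> : expR z * q * (t / (1 + t)) = expR z * q - expR z * (q / (1 + t)).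
    by field; rewrite gt_eqF // addr_gt0.
  rewrite !mulrDr in H; lra.
rewrite mulrA ler_pdivrMr ?addr_gt0 //.
have -> : (t + t ^+ 2) * (1 + t) = (1 + t) ^+ 2 * t by ring.
by rewrite ler_pM2r.
Qed.

Lemma near_min_cpmap_dual m n p (A : 'I_p -> 'M[C]_(m, n)) k
    (Z : 'M[C]_n) (W : 'M[C]_m) (z t : R) :
  Z \in unitmx -> W \in unitmx -> 0 < t ->
  cap_domain (Z *m Z ^t*, W *m W ^t*, z) ->
  near_min A k (Z *m Z ^t*, W *m W ^t*, z) (t ^+ 2) ->
  loewner_le ((expR z)%:C *: cpmap_dual (scaling A (invmx W) (invmx Z)) 1%:M)
    ((1 + t) ^+ 2)%:C%:M.
Proof.
move=> uZ uW t0 /cap_domainE[X1 Y1 z0] wmin.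
rewrite -cpmap_adj -scaling_adj; apply: (near_min_cpmap (k := k)) => //.
  exact/cap_domainE.
move=> [[Y X] z'] /cap_domainE[? ? ?]; rewrite !cap_fun_adj; apply: wmin.
exact/cap_domainE.
Qed.

(** Moving z to z + t changes f_k by e^z s (e^t - 1) - k t, where s is the size of the scaled map.
    This is at least -t^2, and e^t <= 1 / (1 - t) gives e^t - 1 <= t / (1 - t). *)
Lemma near_min_size m n p (A : 'I_p -> 'M[C]_(m, n)) k
    (Z : 'M[C]_n) (W : 'M[C]_m) (z t : R) :
  Z \in unitmx -> W \in unitmx -> 0 < t < 1 ->
  cap_domain (Z *m Z ^t*, W *m W ^t*, z) ->
  near_min A k (Z *m Z ^t*, W *m W ^t*, z) (t ^+ 2) ->
  (k%:R - t) * (1 - t) <=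
  expR z * cpsize (scaling A (invmx W) (invmx Z)).
Proof.
move=> uZ uW /andP[t0 t1] /cap_domainE[X1 Y1 z0] wmin.
have /wmin : cap_domain (Z *m Z ^t*, W *m W ^t*, z + t).
  by apply/cap_domainE; split => //; rewrite addr_ge0 // ltW.
have -> : W *m W ^t* = W *m 1%:M *m W ^t* by rewrite mulmx1.
rewrite !cap_fun_factor ?unitmx1 // invmx1 mulmx1 expRD -/(cpsize _).
set s := cpsize _; set b := ln _; set c := ln _ => H.
have s0 : 0 <= expR z * s.
  by rewrite mulr_ge0 ?expR_ge0 ?cpsize_ge0.
have et : expR t <= (1 - t)^-1.
  rewrite -[t in leLHS]opprK expRN lef_pV2 ?posrE ?expR_gt0 ?subr_gt0 //.
  exact: expR_ge1Dx.
have H1 : expR z * s * expR t <= expR z * s * (1 - t)^-1 by rewrite ler_wpM2l.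
have H2 : k%:R * t - t ^+ 2 <= expR z * s * (t / (1 - t)).
  have -> : expR z * s * (t / (1 - t)) = expR z * s * (1 - t)^-1 - expR z * s.
    by field; rewrite subr_eq0 gt_eqF.
  have E : expR z * expR t * s = expR z * s * expR t by ring.
  rewrite E in H; lra.
move: H2; rewrite mulrA ler_pdivlMr ?subr_gt0 //.
have -> : (k%:R * t - t ^+ 2) * (1 - t) = (k%:R - t) * (1 - t) * t by ring.
by rewrite ler_pM2r.
Qed.

Lemma cap_kscalable m n p (A : 'I_p -> 'M[C]_(m, n)) k :
  (-oo < cap A k)%E -> kscalable A k.
Proof.
move=> capA eps eps0.
(* The size will be at least (k - t)(1 - t) / (1 + t)^2, which to first order is k - (3k + 1) t. The
   bound by 1/2 ensures t < 1. *)
pose t : R := Num.min 2^-1 (eps / (3 * k%:R + 1)).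
have k0 : 0 <= k%:R :> R by [].
have k1 : 0 < 3 * k%:R + 1 :> R by lra.
have t0 : 0 < t by rewrite lt_min invr_gt0 ltr0n /= divr_gt0.
have t2 : t <= 2^-1 by rewrite ge_min lexx.
have te : (3 * k%:R + 1) * t <= eps.
  by rewrite mulrC -ler_pdivlMr // ge_min lexx orbT.
have [[[X Y] z] Dw] := cap_near_min capA (exprn_gt0 2 t0).
have /cap_domainE[X1 Y1 z0] := Dw.
have [Z [uZ XE]] := loewner1_factor X1; have [W [uW YE]] := loewner1_factor Y1.
rewrite {}XE {}YE in Dw * => wmin.
have rowA := near_min_cpmap uZ uW t0 Dw wmin.
have colA := near_min_cpmap_dual uZ uW t0 Dw wmin.
have t01 : 0 < t < 1 by rewrite t0; lra.
have sizeA := near_min_size uZ uW t01 Dw wmin.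
(* Multiplying the left factor by a multiplies Phi and Phi^* by a^2 = e^z / (1 + t)^2, which turns
   both Loewner bounds into bounds by 1. *)
pose a : R := Num.sqrt (expR z) / (1 + t).
have t10 : 0 < 1 + t by lra.
have a0 : a != 0 by rewrite gt_eqF // divr_gt0 // sqrtr_gt0 expR_gt0.
have a2 : a ^+ 2 = expR z / (1 + t) ^+ 2.
  by rewrite expr_div_n sqr_sqrtr // expR_ge0.
have aC : a%:C^* = a%:C :> C by rewrite conj_Creal // complex_real.
set A' := scaling A (invmx W) (invmx Z) in rowA colA sizeA.
have A'E : scaling A (a%:C *: invmx W) (invmx Z) = fun l => a%:C *: A' l.
  by apply/funext => l; rewrite /A' /scaling -!scalemxAl.
have loewnerZ q (M : 'M[C]_q) :
    loewner_le ((expR z)%:C *: M) ((1 + t) ^+ 2)%:C%:M ->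
    loewner_le ((a ^+ 2)%:C *: M) 1%:M.
  have c0 : 0 <= ((1 + t) ^+ 2)^-1 by rewrite invr_ge0 sqr_ge0.
  move=> /(psdmxZ c0); rewrite scalerBr scalerA -rmorphM /= mulrC -a2.
  rewrite scale_scalar_mx -rmorphM /= mulVf ?rmorph1 //.
  by rewrite gt_eqF // exprn_gt0.
have rowE : cpmap (fun l => a%:C *: A' l) 1%:M = (a ^+ 2)%:C *: cpmap A' 1%:M.
  rewrite /cpmap scaler_sumr; apply: eq_bigr => l _.
  by rewrite !mulmx1 adjmxZ aC -scalemxAl -scalemxAr scalerA -rmorphM.
have colE : cpmap_dual (fun l => a%:C *: A' l) 1%:M =
    (a ^+ 2)%:C *: cpmap_dual A' 1%:M.
  rewrite /cpmap_dual scaler_sumr; apply: eq_bigr => l _.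
  by rewrite !mulmx1 adjmxZ aC -scalemxAl -scalemxAr scalerA -rmorphM.
exists (a%:C *: invmx W), (invmx Z); split.
- rewrite -mul_scalar_mx unitmx_mul unitmx_inv uW andbT unitmxE det_scalar.
  by rewrite unitrX // unitfE; apply/eqP => /complexI/eqP; exact/negP.
- by rewrite unitmx_inv.
- rewrite A'E; split; first by rewrite rowE; exact: loewnerZ.
  by rewrite colE; exact: loewnerZ.
- rewrite A'E /cpsize rowE mxtraceZ Re_realM -/(cpsize A') a2 mulrAC.
  rewrite ler_pdivlMr ?exprn_gt0 //.
  have [ke|ke] := leP (k%:R - eps) 0.
    apply: (@le_trans _ _ 0); first by rewrite mulr_le0_ge0 // sqr_ge0.
    by rewrite mulr_ge0 ?expR_ge0 ?cpsize_ge0.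
  apply: le_trans sizeA.
  apply: (@le_trans _ _ ((k%:R - (3 * k%:R + 1) * t) * (1 + t) ^+ 2)).
    by rewrite ler_wpM2r ?sqr_ge0 // lerD2l lerN2.
  have kt : 0 <= k%:R * t by rewrite mulr_ge0 // ltW.
  have ktt : 0 <= k%:R * t * t by rewrite mulr_ge0 // ltW.
  have kttt : 0 <= k%:R * t * t * t by rewrite mulr_ge0 // ltW.
  have tt : 0 <= t * t by rewrite mulr_ge0 // ltW.
  have ttt : 0 <= t * t * t by rewrite mulr_ge0 // ltW.
  rewrite -subr_ge0.
  (* The first-order terms cancel by the choice of 3k + 1, and the remaining coefficients are
     nonnegative. *)
  have -> : (k%:R - t) * (1 - t) - (k%:R - (3 * k%:R + 1) * t) * (1 + t) ^+ 2 =
    5 * (k%:R * t * t) + 3 * (t * t) + 3 * (k%:R * t * t * t) + t * t * t by ring.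
  lra.
Qed.

End NearMinimizers.

(** * Compactness of the set of orthonormal frames *)

Section ComplexLimits.
Variable R : realType.
Local Notation C := R[i].

(** By compactness the image filter clusters at some l in [-1, 1]. If the preimage of a
    neighbourhood B of l were not in F, that of the complement would be, and the complement would
    have to meet B. *)
Lemma ultra_bounded_cvg (T : Type) (F : set_system T) (g : T -> R) :
  UltraFilter F -> (forall t, `|g t| <= 1) -> exists l : R, g @ F --> l.
Proof.
move=> UF g1; have FF := @ultra_proper _ _ UF.
have gA : (g @ F) `[(-1), 1]%classic.
  by apply: (@filterE _ F) => t /=; rewrite in_itv /= -ler_norml.
have [l [_ cl]] := @segment_compact R (-1) 1 _ _ gA.
exists l => B nB; rewrite /= nbhs_filterE.
have [//|FB] := in_ultra_setVsetC (g @^-1` B) UF.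
have [y [yB By]] := cl (~` B) B FB nB.
by case: (yB By).
Qed.

(** Convergence of both coordinates reduces complex limits to limits in [R]. *)
Definition ccvg (T : Type) (F : set_system T) (f : T -> C) (l : C) :=
  (complex.Re (f t) @[t --> F] --> complex.Re l) /\
  (complex.Im (f t) @[t --> F] --> complex.Im l).

Section CCvg.
Variables (T : Type) (F : set_system T) (FF : ProperFilter F).

Lemma ccvg_cst (c : C) : ccvg F (fun=> c) c.
Proof. by split; exact: cvg_cst. Qed.

Lemma ccvgD f g a b : ccvg F f a -> ccvg F g b ->
  ccvg F (fun t => f t + g t) (a + b).
Proof.
move=> [fr fi] [gr gi]; split; rewrite raddfD; under eq_fun do rewrite raddfD;
exact: cvgD.
Qed.

Lemma ccvgM f g a b : ccvg F f a -> ccvg F g b ->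
  ccvg F (fun t => f t * g t) (a * b).
Proof.
have ReM (x y : C) : complex.Re (x * y) =
    complex.Re x * complex.Re y - complex.Im x * complex.Im y.
  by case: x => ? ?; case: y.
have ImM (x y : C) : complex.Im (x * y) =
    complex.Re x * complex.Im y + complex.Im x * complex.Re y.
  by case: x => ? ?; case: y.
move=> [fr fi] [gr gi]; split.
  by rewrite ReM; under eq_fun do rewrite ReM; apply: cvgB; exact: cvgM.
by rewrite ImM; under eq_fun do rewrite ImM; apply: cvgD; exact: cvgM.
Qed.

Lemma ccvg_conj f a : ccvg F f a -> ccvg F (fun t => (f t)^*) a^*.
Proof.
have ReC (x : C) : complex.Re x^* = complex.Re x by case: x.
have ImC (x : C) : complex.Im x^* = - complex.Im x by case: x.
move=> [fr fi]; split.
  by rewrite ReC; under eq_fun do rewrite ReC.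
by rewrite ImC; under eq_fun do rewrite ImC; exact: cvgN.
Qed.

Lemma ccvg_sum (I : finType) (f : I -> T -> C) (a : I -> C) :
  (forall i, ccvg F (f i) (a i)) ->
  ccvg F (fun t => \sum_i f i t) (\sum_i a i).
Proof.
move=> fa; elim: (index_enum I) => [|i r IH].
  rewrite big_nil; under [X in ccvg _ X]eq_fun do rewrite big_nil.
  exact: ccvg_cst.
rewrite big_cons; under [X in ccvg _ X]eq_fun do rewrite big_cons.
exact: ccvgD.
Qed.

Lemma ccvg_unique f a b : ccvg F f a -> ccvg F f b -> a = b.
Proof.
move=> [ar ai] [br bi]; apply/eqP; rewrite eq_complex.
by rewrite (cvg_unique _ ar br) ?(cvg_unique _ ai bi) ?eqxx //; exact: Rhausdorff.
Qed.

Lemma ccvg_ext f g a : f =1 g -> ccvg F f a -> ccvg F g a.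
Proof. by move=> /funext ->. Qed.

Definition mxcvg m n (M : T -> 'M[C]_(m, n)) (L : 'M[C]_(m, n)) :=
  forall i j, ccvg F (fun t => M t i j) (L i j).

Lemma mxcvg_mul m n q (M : T -> 'M[C]_(m, n)) (N : T -> 'M[C]_(n, q)) L L' :
  mxcvg M L -> mxcvg N L' -> mxcvg (fun t => M t *m N t) (L *m L').
Proof.
move=> ML NL i j; rewrite mxE.
apply: (@ccvg_ext (fun t => \sum_k M t i k * N t k j)).
  by move=> t; rewrite mxE.
by apply: ccvg_sum => k; exact: ccvgM.
Qed.

Lemma mxcvg_adj m n (M : T -> 'M[C]_(m, n)) L :
  mxcvg M L -> mxcvg (fun t => (M t) ^t*) (L ^t*).
Proof.
move=> ML i j; rewrite !mxE; apply: (@ccvg_ext (fun t => (M t j i)^*)).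
  by move=> t; rewrite !mxE.
exact: ccvg_conj.
Qed.

Lemma mxcvg_cst m n (M : 'M[C]_(m, n)) : mxcvg (fun=> M) M.
Proof. by move=> i j; exact: ccvg_cst. Qed.

Lemma mxcvg_unique m n (M : T -> 'M[C]_(m, n)) L L' :
  mxcvg M L -> mxcvg M L' -> L = L'.
Proof.
by move=> ML ML'; apply/matrixP => i j; exact: ccvg_unique (ML i j) (ML' i j).
Qed.

End CCvg.

Lemma Re_le_norm (x : C) (c : R) : `|x| <= c%:C -> `|complex.Re x| <= c.
Proof.
move=> xc; rewrite -lecR; apply: le_trans xc; case: x => a b.
by rewrite normc_def /= lecR -sqrtr_sqr ler_wsqrtr // lerDl sqr_ge0.
Qed.

Lemma Im_le_norm (x : C) (c : R) : `|x| <= c%:C -> `|complex.Im x| <= c.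
Proof.
move=> xc; rewrite -lecR; apply: le_trans xc; case: x => a b.
by rewrite normc_def /= lecR -sqrtr_sqr ler_wsqrtr // lerDr sqr_ge0.
Qed.

Lemma unitarymx_entry_le1 m n (V : 'M[C]_(m, n)) i j :
  V \is unitarymx -> `|V i j| <= 1.
Proof.
move=> /unitarymxP/matrixP/(_ i i).
rewrite !mxE eqxx mulr1n (bigD1 j) //= !mxE -normCK => E.
rewrite -(@expr_le1 _ 2) // -E lerDl sumr_ge0 // => k _.
by rewrite !mxE mul_conjC_ge0.
Qed.

(** Compactness of the Stiefel manifold: the entries have modulus at most 1, so they converge along
    the ultrafilter, and V V^* = 1 passes to the limit. *)
Lemma unitarymx_ultra_cvg (T : Type) (F : set_system T) m n
    (V : T -> 'M[C]_(m, n)) :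
  UltraFilter F -> (forall t, V t \is unitarymx) ->
  exists2 L, L \is unitarymx & mxcvg F V L.
Proof.
move=> UF uV; have FF := @ultra_proper _ _ UF.
have lim i j : exists l, ccvg F (fun t => V t i j) l.
  have [a ra] : exists a : R, complex.Re (V t i j) @[t --> F] --> a.
    by apply: (ultra_bounded_cvg (g := fun t => complex.Re (V t i j))) => t;
      exact/Re_le_norm/unitarymx_entry_le1.
  have [b rb] : exists b : R, complex.Im (V t i j) @[t --> F] --> b.
    by apply: (ultra_bounded_cvg (g := fun t => complex.Im (V t i j))) => t;
      exact/Im_le_norm/unitarymx_entry_le1.
  by exists (a +i* b).
have [L LP] := choice (fun ij => lim ij.1 ij.2).
pose M := \matrix_(i, j) L (i, j).
have ML : mxcvg F V M by move=> i j; rewrite mxE; exact: (LP (i, j)).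
exists M => //; apply/unitarymxP.
apply: (mxcvg_unique FF (mxcvg_mul FF ML (mxcvg_adj FF ML))).
move=> i j; apply: (ccvg_ext _ (ccvg_cst FF _)) => t.
by rewrite (unitarymxP (uV t)).
Qed.

(** F refines the filter at infinity, so limits along the latter are limits along F. *)
Lemma ccvg_squeeze0 (F : set_system nat) (f : nat -> C) :
  ProperFilter F -> \oo `<=` F -> (forall t, `|f t| <= (t.+1%:R^-1)%:C) ->
  ccvg F f 0.
Proof.
move=> FF ooF f1.
have sq (g : nat -> R) : (forall t, `|g t| <= t.+1%:R^-1) -> g @ F --> (0 : R).
  move=> g1; have : g @ \oo --> (0 : R).
    apply: (squeeze_cvgr (f := fun t => - harmonic t) (h := harmonic)).
    - by apply: nearW => t; rewrite -ler_norml; exact: g1.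
    - by rewrite -oppr0; apply: cvgN; exact: cvg_harmonic.
    - exact: cvg_harmonic.
  by move=> h B nB; apply: ooF; exact: h.
by split; apply: sq => t; [apply: Re_le_norm|apply: Im_le_norm].
Qed.

End ComplexLimits.

(** * A uniform lower bound for the largest entry between large frames *)

Section Compactness.
Variables (R : realType) (m n p : nat).
Local Notation C := R[i].
Implicit Type A : 'I_p -> 'M[C]_(m, n).

(** Otherwise, for every t, some frames have all entries at most 1 / (t + 1). Their limits along an
    ultrafilter are orthonormal frames annihilating every A_l, so the rank is at most m + n - a - b
    < k. *)
Lemma ncrank_frame_entry A k a b :
  (k <= ncrank A)%N -> (m + n < a + b + k)%N ->
  exists2 delta : R, 0 < delta &
    forall (V : 'M[C]_(a, m)) (U : 'M[C]_(b, n)),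
      V \is unitarymx -> U \is unitarymx ->
      exists l i j, delta%:C <= `|(V *m A l *m U ^t*) i j|.
Proof.
move=> kA abk; apply: contrapT => nodelta.
have ex (t : nat) : exists VU : 'M[C]_(a, m) * 'M[C]_(b, n),
    [/\ VU.1 \is unitarymx, VU.2 \is unitarymx
      & forall l i j, `|(VU.1 *m A l *m VU.2 ^t*) i j| <= (t.+1%:R^-1)%:C].
  apply: contrapT => noVU; apply: nodelta; exists t.+1%:R^-1 => // V U uV uU.
  apply: contrapT => nol; apply: noVU; exists (V, U); split => //= l i j.
  rewrite real_leNgt ?normr_real ?complex_real //.
  by apply/negP => h; apply: nol; exists l, i, j; exact: ltW.
have [W WP] := choice ex.
have [F [UF ooF]] := @ultraFilterLemma nat \oo _.
have FF := @ultra_proper _ _ UF.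
have [V uV cV] := @unitarymx_ultra_cvg R _ F _ _ (fun t => (W t).1) UF
  (fun t => let: And3 h _ _ := WP t in h).
have [U uU cU] := @unitarymx_ultra_cvg R _ F _ _ (fun t => (W t).2) UF
  (fun t => let: And3 _ h _ := WP t in h).
have VAU l : V *m A l *m U ^t* = 0.
  apply: (mxcvg_unique FF (mxcvg_mul FF (mxcvg_mul FF cV (mxcvg_cst FF (A l)))
    (mxcvg_adj FF cU))) => i j.
  rewrite mxE; apply: ccvg_squeeze0 => // t.
  by case: (WP t).
(* The existence of the frames bounds their sizes, so the truncated subtraction is exact. *)
have am : (a <= m)%N by rewrite -(mxrank_unitary uV) rank_leq_col.
have bn : (b <= n)%N by rewrite -(mxrank_unitary uU) rank_leq_col.
have := leq_trans kA (ncrank_le_frame uV uU VAU); lia.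
Qed.

End Compactness.

(** * Large rank bounds the capacity from below *)

Section RankToCap.
Variables (R : realType) (m n p : nat).
Local Notation C := R[i].
Implicit Type A : 'I_p -> 'M[C]_(m, n).

Lemma rowsub_unitarymx a q (f : 'I_a -> 'I_q) (U : 'M[C]_q) :
  injective f -> U \is unitarymx -> rowsub f U \is unitarymx.
Proof.
move=> injf /unitarymxP/matrixP UU; apply/unitarymxP/matrixP => i j.
rewrite [RHS]mxE -(inj_eq injf); have := UU (f i) (f j).
rewrite [in RHS]mxE => <-; rewrite !mxE.
by apply: eq_bigr => k _; rewrite !mxE.
Qed.

Lemma unitarymx_empty q (M : 'M[C]_(0, q)) : M \is unitarymx.
Proof. by apply/unitarymxP/matrixP => -[]. Qed.

Lemma unitarymx1 q : (1%:M : 'M[C]_q) \is unitarymx.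
Proof. by apply/unitarymxP; rewrite mul1mx adjmx1. Qed.

(** The zero space and all of C^n form an annihilating pair of value m. *)
Lemma ncrank_le_rows A : (ncrank A <= m)%N.
Proof.
have := @ncrank_le_frame _ _ _ _ A _ _ _ _ (unitarymx_empty 0) (unitarymx1 n).
by rewrite subn0 addnK; apply => l; apply/matrixP => -[].
Qed.

Lemma ncrank_le_cols A : (ncrank A <= n)%N.
Proof.
have := @ncrank_le_frame _ _ _ _ A _ _ _ _ (unitarymx1 m) (unitarymx_empty 0).
by rewrite subn0 addnC addnK; apply => l; apply/matrixP => i -[].
Qed.

Fact tail_ord_subproof a q (i : 'I_(q - a)) : (a + i < q)%N.
Proof. by have := ltn_ord i; lia. Qed.

(** With decreasing eigenvalues, the rows of [U] at these positions belong to the q - a smallest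
    ones. *)
Definition tail_ord a q (i : 'I_(q - a)) : 'I_q :=
  Ordinal (tail_ord_subproof i).

Lemma tail_ord_inj a q : injective (@tail_ord a q).
Proof. by move=> i j [/addnI ij]; exact: val_inj. Qed.

Lemma ler_sum_term (K : numDomainType) (I : finType) (F : I -> K) i :
  (forall i, 0 <= F i) -> F i <= \sum_i F i.
Proof. by move=> F0; rewrite (bigD1 i) //= lerDl sumr_ge0. Qed.

Lemma ler_sum_inj (I J : finType) (h : I -> J) (F : J -> R) : injective h ->
  (forall j, 0 <= F j) -> \sum_i F (h i) <= \sum_j F j.
Proof.
move=> injh F0; have -> : \sum_i F (h i) = \sum_(j in codom h) F j.
  by rewrite -big_uniq; [rewrite [RHS]big_image|exact/injectiveP].
rewrite [leRHS](bigID (mem (codom h))) /= lerDl.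
by apply: sumr_ge0 => j _; exact: F0.
Qed.

Lemma ln_prod (I : finType) (F : I -> R) : (forall i, 0 < F i) ->
  ln (\prod_i F i) = \sum_i ln (F i).
Proof.
move=> F0; rewrite -[RHS]expRK expR_sum; congr ln.
by apply: eq_bigr => i _; rewrite lnK ?posrE.
Qed.

Lemma mxtrace_cpmap_spectral A (U : 'M[C]_n) (V : 'M[C]_m) d e :
  \tr (cpmap A (U ^t* *m rdiag d *m U) *m (V ^t* *m rdiag e *m V)) =
  \sum_l \sum_i \sum_j (e i * d j)%:C * `|(V *m A l *m U ^t*) i j| ^+ 2.
Proof.
rewrite /cpmap mulmx_suml mxtrace_sum; apply: eq_bigr => l _.
under eq_bigr => i _ do under eq_bigr => j _ do rewrite rmorphM.
transitivity (\tr (rdiag e *m (V *m A l *m U ^t*) *m rdiag d *m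
    (V *m A l *m U ^t*) ^t*)).
  rewrite !adjmxM trmxCK !mulmxA [LHS]mxtrace_mulC !mulmxA.
  by rewrite [LHS]mxtrace_mulC !mulmxA.
rewrite mxtrace_diag_conj; apply: eq_bigr => i _; apply: eq_bigr => j _.
by rewrite !mxE.
Qed.

(** This is e^u >= 1 + u at u = w + ln c. *)
Lemma expR_tangent (c w : R) : 0 < c -> 1 + ln c + w <= c * expR w.
Proof.
by move=> c0; rewrite -{2}[c]lnK ?posrE // -expRD -addrA; exact: expR_ge1Dx.
Qed.

Lemma ncrank_cap A k : (k <= ncrank A)%N -> (-oo < cap A k)%E.
Proof.
move=> kA.
have km : (k <= m)%N := leq_trans kA (ncrank_le_rows A).
have kn : (k <= n)%N := leq_trans kA (ncrank_le_cols A).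
(* As [rev_ord a] is k - 1 - a, the two frames have m + n - k + 1 rows together, one more than an
   annihilating pair can have. *)
have ex (a : 'I_k) : exists delta : R, 0 < delta /\
    forall (V : 'M[C]_(m - a, m)) (U : 'M[C]_(n - rev_ord a, n)),
      V \is unitarymx -> U \is unitarymx ->
      exists l i j, delta%:C <= `|(V *m A l *m U ^t*) i j|.
  have [|delta d0 dP] := @ncrank_frame_entry _ _ _ _ A k (m - a) (n - rev_ord a) kA.
    by have := ltn_ord a; rewrite /=; lia.
  by exists delta.
have [delta deltaP] := choice ex.
(* The factor 1/k is the weight of each a in the average. *)
pose c a := delta a ^+ 2 / k%:R.
have kR (a : 'I_k) : 0 < k%:R :> R.
  by rewrite ltr0n; exact: leq_ltn_trans (ltn_ord a).
have c0 a : 0 < c a.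
  by rewrite divr_gt0 ?exprn_gt0 ?(kR a) //; case: (deltaP a).
(* These are the constant terms of the k tangent lines. *)
pose lb := \sum_a (1 + ln (c a)).
apply: (@lt_le_trans _ _ lb%:E); first by rewrite ltNyr.
apply: le_ereal_inf_tmp => _ [[[X Y] z] /cap_domainE[X1 Y1 z0] <-].
rewrite lee_fin /cap_fun.
have [U [d [uU XE d1 dS]]] := loewner1_spectral X1.
have [V [e [uV YE e1 eS]]] := loewner1_spectral Y1.
have d0 j : 0 < d j by exact: lt_le_trans ltr01 (d1 j).
have e0 i : 0 < e i by exact: lt_le_trans ltr01 (e1 i).
rewrite mxtraceZ Re_realM XE YE !det_spectral // !invmx_spectral //; last 2 first.
- by move=> i; rewrite gt_eqF.
- by move=> j; rewrite gt_eqF.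
rewrite /= !ln_prod // mxtrace_cpmap_spectral.
set T0 := \sum_l _; set T := expR z * _.
have term0 l i j : 0 <= ((e i)^-1 * (d j)^-1)%:C *
    `|(V *m A l *m U ^t*) i j| ^+ 2.
  by rewrite mulr_ge0 ?exprn_ge0 // ler0c mulr_ge0 // invr_ge0 ltW.
have T00 : 0 <= T.
  rewrite mulr_ge0 ?expR_ge0 //; apply: Re_ge0; apply: sumr_ge0 => l _.
  by apply: sumr_ge0 => i _; apply: sumr_ge0.
(* The two tails start at positions a and k - 1 - a, where their largest eigenvalues sit. *)
pose ia (a : 'I_k) : 'I_m := widen_ord km a.
pose jb (a : 'I_k) : 'I_n := widen_ord kn (rev_ord a).
pose w a := z - ln (e (ia a)) - ln (d (jb a)).
have Tw a : delta a ^+ 2 * expR (w a) <= T.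
  have [da0 dP] := deltaP a.
  have [l [i [j dl]]] := dP _ _
    (rowsub_unitarymx (@tail_ord_inj a m) uV)
    (rowsub_unitarymx (@tail_ord_inj (rev_ord a) n) uU).
  pose i' := tail_ord i; pose j' := tail_ord j.
  (* An entry between the tails is an entry of the full V A_l U^* at shifted positions. *)
  have {}dl : (delta a)%:C <= `|(V *m A l *m U ^t*) i' j'|.
    apply: le_trans dl _; rewrite le_eqVlt; apply/orP; left; apply/eqP; congr `|_|.
    rewrite !mxE; apply: eq_bigr => q _; rewrite !mxE; congr (_ * _).
    by apply: eq_bigr => r _; rewrite !mxE.
  have ei : e i' <= e (ia a) by apply: eS; rewrite /= leq_addr.
  have dj : d j' <= d (jb a) by apply: dS; rewrite /= leq_addr.
  have -> : delta a ^+ 2 * expR (w a) =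
      expR z * (delta a ^+ 2 * ((e (ia a))^-1 * (d (jb a))^-1)).
    by rewrite /w !expRD !expRN !lnK ?posrE //; ring.
  rewrite /T ler_pM2l ?expR_gt0 //.
  (* Among the nonnegative terms of [T0], the single one at l, i', j' suffices. *)
  have : ((e i')^-1 * (d j')^-1 * delta a ^+ 2)%:C <= T0.
    apply: (@le_trans _ _ (((e i')^-1 * (d j')^-1)%:C *
        `|(V *m A l *m U ^t*) i' j'| ^+ 2)).
      rewrite rmorphM /= ler_wpM2l ?ler0c ?mulr_ge0 ?invr_ge0 //;
        try exact: ltW.
      by rewrite rmorphXn /= lerXn2r ?nnegrE ?normr_ge0 ?ler0c ?(ltW da0).
    apply: le_trans (@ler_sum_term _ _ _ l _) => [|l']; last first.
      by apply: sumr_ge0 => i'' _; apply: sumr_ge0.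
    apply: le_trans (@ler_sum_term _ _ _ i' _) => [|i'']; last first.
      by apply: sumr_ge0.
    exact: (@ler_sum_term _ _ (fun j => ((e i')^-1 * (d j)^-1)%:C *
      `|(V *m A l *m U ^t*) i' j| ^+ 2) j').
  rewrite lecE => /andP[_] /=; apply: le_trans.
  rewrite mulrC ler_pM2r ?exprn_gt0 //.
  by rewrite ler_pM ?invr_ge0 ?(ltW (e0 _)) ?(ltW (d0 _)) ?lef_pV2 ?posrE.
have Tsum : \sum_a (c a * expR (w a)) <= T.
  (* For k = 0 the sum is empty and T >= 0 suffices; otherwise each term is at most T / k. *)
  have [k0|k0] := posnP k.
    apply: le_trans T00; rewrite big1 // => a _.
    by have := ltn_ord a; rewrite {2}k0.
  apply: (@le_trans _ _ (\sum_(a < k) T / k%:R)).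
    apply: ler_sum => a _; rewrite /c mulrAC ler_pM2r ?invr_gt0 ?(kR a) //.
  by rewrite sumr_const card_ord -(mulr_natr (T / k%:R)) divfK // pnatr_eq0 -lt0n.
have lbT : lb + \sum_a w a <= T.
  apply: le_trans Tsum; rewrite /lb -big_split /=; apply: ler_sum => a _.
  exact: expR_tangent.
(* The tangent lines contribute exactly k z, which cancels the term -k z of f_k. *)
have sumw : \sum_a w a = k%:R * z - \sum_a ln (e (ia a)) - \sum_a ln (d (jb a)).
  by rewrite /w !sumrB sumr_const card_ord mulr_natl.
have injia : injective ia by move=> a b /(congr1 val) /= ab; exact: val_inj.
have injjb : injective jb.
  by move=> a b /(congr1 val) /= ab; apply: rev_ord_inj; exact: val_inj.
(* The eigenvalues are at least 1, so the logarithms beyond the first k positions only increase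
   f_k. *)
have He : \sum_a ln (e (ia a)) <= \sum_i ln (e i).
  by apply: (ler_sum_inj (F := fun i => ln (e i))) => // i; exact: ln_ge0.
have Hd : \sum_a ln (d (jb a)) <= \sum_i ln (d i).
  by apply: (ler_sum_inj (F := fun i => ln (d i))) => // i; exact: ln_ge0.
by clear kR; rewrite sumw in lbT; lra.
Qed.

End RankToCap.

Theorem theorem3p9 (R : realType) (m n p : nat)
    (A : 'I_p -> 'M[complex R]_(m, n)) (k : nat) :
  ((k <= ncrank A)%N <-> kscalable A k) /\
  (kscalable A k <-> (-oo < cap A k)%E).
Proof.
have rank_cap := @ncrank_cap R m n p A k.
have cap_scal := @cap_kscalable R m n p A k.
have scal_rank := @kscalable_ncrank R m n p A k.
split; split => h.
- exact/cap_scal/rank_cap.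
- exact: scal_rank.
- exact/rank_cap/scal_rank.
- exact: cap_scal.
Qed.
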